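(* Let $N\ge 2$ be an integer, let $k$ be an integer with $\lfloor\frac{N-1}{2}\rfloor\le k\le N-1$, let $\sigma>0$ and $p,\kappa\ge 0$, and set $\Theta_N=N^{(1+\kappa)\wedge 2}$. Let $(\eta(t))_{t\ge 0}$ be the Markov process driven by the generator $\mathcal{L}_N=\Theta_N\big(\sigma\mathcal{L}_N^{\mathrm S}+pN^{-\kappa}\mathcal{L}_N^{\mathrm{TA}}\big)$ of the facilitated exclusion process with closed boundaries, starting from an ergodic configuration $\eta(0)\in\mathcal{E}_N^k$. Then $\xi(t):=\phi(\eta(t))$ is a Markov process evolving on $\Omega_M^\ell$ with $(M,\ell)=(k+2,\,2k-N+2)$, and its generator reads $$\mathbb{L}_N=\Theta_N\big(\sigma\mathbb{L}_M^{\mathrm S}+pN^{-\kappa}\mathbb{L}_M^{\mathrm{TA}}\big),$$ where for $f:\Omega_M^\ell\to\mathbb{R}$, $$\mathbb{L}_M^{\mathrm S}f(\xi)=\sum_{y=1}^{M-2}\big[f(\xi^{y,y+1})-f(\xi)\big],\qquad \mathbb{L}_M^{\mathrm{TA}}f(\xi)=\sum_{y=1}^{M-2}\xi_y(1-\xi_{y+1})\big[f(\xi^{y,y+1})-f(\xi)\big].$$ Namely, $(\xi(t))_{t\ge 0}$ is a simple exclusion process on $\Lambda_M$ in which (up to the time acceleration $\Theta_N$) a particle jumps to its right (resp. left) neighbour with rate $\sigma+pN^{-\kappa}$ (resp. $\sigma$).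
   Context: For an integer $N\ge 2$, $\Lambda_N=\{1,\dots,N-1\}$ and $\Omega_N=\{0,1\}^{\Lambda_N}$. For $\eta\in\Omega_N$ and $x,x'\in\Lambda_N$, $\eta^{x,x'}$ is the configuration obtained from $\eta$ by exchanging the values $\eta_x$ and $\eta_{x'}$. For $f:\Omega_N\to\mathbb{R}$, $$\mathcal{L}_N^{\mathrm S}f(\eta)=\sum_{x=1}^{N-2}\big(\eta_{x-1}\eta_x(1-\eta_{x+1})+(1-\eta_x)\eta_{x+1}\eta_{x+2}\big)\big[f(\eta^{x,x+1})-f(\eta)\big],$$ $$\mathcal{L}_N^{\mathrm{TA}}f(\eta)=\sum_{x=1}^{N-2}\eta_{x-1}\eta_x(1-\eta_{x+1})\big[f(\eta^{x,x+1})-f(\eta)\big],$$ with the convention $\eta_0=\eta_N=1$. The ergodic component is $\mathcal{E}_N=\{\eta\in\Omega_N:\ \eta_x+\eta_{x+1}\ge 1\ \text{for all}\ \{x,x+1\}\subset\Lambda_N\}$. For an integer $k$, $\Omega_N^k=\{\eta\in\Omega_N:\ \sum_{x\in\Lambda_N}\eta_x=k\}$ and $\mathcal{E}_N^k=\mathcal{E}_N\cap\Omega_N^k$. The set $\mathcal{E}_N^k$ (with $k\le N-1$) is non-empty if and only if $k\ge\lfloor\frac{N-1}{2}\rfloor$. The map $\phi$: given $\eta\in\mathcal{E}_N^k$, extend it to a configuration $\bar\eta$ on $\{0,\dots,N\}$ by setting $\bar\eta_0=\bar\eta_N=1$. Number the particles (occupied sites) of $\bar\eta$ lying in $\{0,\dots,N-1\}$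 from left to right from $1$ to $M-1$, where $M-1=k+1$. Define $\xi=\phi(\eta)\in\Omega_M$ by $\xi_y=1$ if and only if the $y$-th particle of $\bar\eta$ has a particle on its right neighbouring site, for $y\in\Lambda_M=\{1,\dots,M-1\}$. Then $\phi$ is a bijection from $\mathcal{E}_N^k$ to $\Omega_M^\ell$ with $(M,\ell)=(k+2,2k-N+2)$. *)

(* Defs.v *)
From HB Require Import structures.
From mathcomp Require Import all_boot all_order all_algebra all_fingroup.
From mathcomp Require Import all_classical all_reals all_analysis.

Set Implicit Arguments.
Unset Strict Implicit.
Unset Printing Implicit Defensive.

Import Order.TTheory GRing.Theory Num.Theory.
Import numFieldNormedType.Exports.

Local Open Scope classical_set_scope.
Local Open Scope ring_scope.

(* {0,1}^{1, ..., N-1}: the ordinal i : 'I_N.-1 stands for the site i.+1. *)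
Definition Omega (N : nat) : finType := {ffun 'I_N.-1 -> bool}.

Definition site (N x : nat) : option 'I_N.-1 :=
  if x is y.+1 then insub y else None.

(* The occupation variable eta_x, including the closed boundary convention
   eta_0 = eta_N = 1 (sites beyond N also read 1 but are never consulted). *)
Definition occ (N : nat) (eta : Omega N) (x : nat) : bool :=
  if site N x is Some i then eta i else true.

(* eta^{x,x'}; only used for x, x' in {1, ..., N-1}. *)
Definition exch (N : nat) (eta : Omega N) (x x' : nat) : Omega N :=
  match site N x, site N x' with
  | Some i, Some j => [ffun z => eta (tperm i j z)]
  | _, _ => eta
  end.

Definition nparticles (N : nat) (eta : Omega N) : nat :=
  (\sum_(i < N.-1) eta i)%N.

Definition Omega_k (N k : nat) : finType :=
  {eta : Omega N | nparticles eta == k}.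

Lemma nparticles_exch (N : nat) (eta : Omega N) (x x' : nat) :
  nparticles (exch eta x x') = nparticles eta.
Proof.
rewrite /exch; case: (site N x) => [i|//]; case: (site N x') => [j|//].
rewrite /nparticles [RHS](reindex_inj (@perm_inj _ (tperm i j))) /=.
by apply: eq_bigr => z _; rewrite ffunE.
Qed.

Lemma exch_k_subproof (N k : nat) (eta : Omega_k N k) (x x' : nat) :
  nparticles (exch (sval eta) x x') == k.
Proof. by rewrite nparticles_exch; exact: (svalP eta). Qed.

Definition exch_k (N k : nat) (eta : Omega_k N k) (x x' : nat) : Omega_k N k :=
  exist _ (exch (sval eta) x x') (exch_k_subproof eta x x').

Definition ergodic (N : nat) (eta : Omega N) : Prop :=
  forall x : nat, (1 <= x)%N -> (x.+1 <= N.-1)%N ->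
    (1 <= occ eta x + occ eta x.+1)%N.

Definition ergodic_k (N k : nat) (eta : Omega N) : Prop :=
  ergodic eta /\ nparticles eta = k.

(* Positions, from left to right, of the particles of the extended
   configuration lying in {0, ..., N-1}. *)
Definition particles (N : nat) (eta : Omega N) : seq nat :=
  [seq x <- iota 0 N | occ eta x].

(* phi is made total on Omega N; when nparticles eta = k the list of particles
   has exactly k+1 entries, one for each site of {1, ..., k+1}, and the default
   value of nth is never used. *)
Definition phi (N k : nat) (eta : Omega N) : Omega k.+2 :=
  [ffun y : 'I_k.+1 => occ eta (nth 0%N (particles eta) y).+1].

Definition LS (R : realType) (N : nat) (f : Omega N -> R) (eta : Omega N) : R :=
  \sum_(1 <= x < N.-1)
    ((occ eta x.-1)%:R * (occ eta x)%:R * (1 - (occ eta x.+1)%:R)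
     + (1 - (occ eta x)%:R) * (occ eta x.+1)%:R * (occ eta x.+2)%:R)
    * (f (exch eta x x.+1) - f eta).

Definition LTA (R : realType) (N : nat) (f : Omega N -> R) (eta : Omega N) : R :=
  \sum_(1 <= x < N.-1)
    (occ eta x.-1)%:R * (occ eta x)%:R * (1 - (occ eta x.+1)%:R)
    * (f (exch eta x x.+1) - f eta).

Definition Theta (R : realType) (kappa : R) (N : nat) : R :=
  N%:R `^ Num.min (1 + kappa) 2.

Definition FEP_generator (R : realType) (sigma p kappa : R) (N : nat)
    (f : Omega N -> R) (eta : Omega N) : R :=
  Theta kappa N * (sigma * LS f eta + p * N%:R `^ (- kappa) * LTA f eta).

Definition EPS (R : realType) (M l : nat) (f : Omega_k M l -> R)
    (xi : Omega_k M l) : R :=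
  \sum_(1 <= y < M.-1) (f (exch_k xi y y.+1) - f xi).

Definition EPTA (R : realType) (M l : nat) (f : Omega_k M l -> R)
    (xi : Omega_k M l) : R :=
  \sum_(1 <= y < M.-1)
    (occ (sval xi) y)%:R * (1 - (occ (sval xi) y.+1)%:R)
    * (f (exch_k xi y y.+1) - f xi).

(* N is the scaling parameter of the original process, M the new size. *)
Definition EP_generator (R : realType) (sigma p kappa : R) (N M l : nat)
    (f : Omega_k M l -> R) (xi : Omega_k M l) : R :=
  Theta kappa N * (sigma * EPS f xi + p * N%:R `^ (- kappa) * EPTA f xi).

(* Simple exclusion on {1, ..., M-1}, jumping to the right at rate a and to the
   left at rate b, with l particles. *)
Definition SEP_generator (R : realType) (a b : R) (M l : nat)
    (f : Omega_k M l -> R) (xi : Omega_k M l) : R :=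
  \sum_(1 <= y < M.-1)
    (a * (occ (sval xi) y)%:R * (1 - (occ (sval xi) y.+1)%:R)
     + b * (1 - (occ (sval xi) y)%:R) * (occ (sval xi) y.+1)%:R)
    * (f (exch_k xi y y.+1) - f xi).

(* e^{tL} f (x) = \sum_n t^n / n! (L^n f)(x). *)
Definition semigroup (R : realType) (E : finType) (L : (E -> R) -> (E -> R))
    (t : R) (f : E -> R) (x : E) : R :=
  limn (series (fun n : nat => t ^+ n / n`!%:R * iter n L f x)).

Definition cadlag (R : realType) (S : Type) (w : R -> S) : Prop :=
  (forall t : R, 0 <= t -> \forall s \near t^'+, w s = w t) /\
  (forall t : R, 0 < t -> exists x : S, \forall s \near t^'-, w s = x).

(* X is a process with values in the finite set S, indexed by the times t >= 0
   (its values at t < 0 are irrelevant).  It is a Markov process evolving on E,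
   seen as a subset of S through the injection j, with generator L: almost
   surely it never leaves E, and it satisfies the Markov property with respect
   to its own past, with transition semigroup e^{tL}. *)
Definition markov_process (R : realType) (d : measure_display)
    (T : measurableType d) (P : probability T R) (S E : finType) (j : E -> S)
    (L : (E -> R) -> (E -> R)) (X : R -> T -> S) : Prop :=
  [/\ forall (t : R) (s : S), 0 <= t -> measurable [set w | X t w = s],
      forall w : T, cadlag (fun t : R => X t w),
      {ae P, forall w, forall t : R, 0 <= t -> exists x : E, X t w = j x}
    & forall (n : nat) (t : nat -> R) (x : nat -> E),
        0 <= t 0%N -> (forall i : nat, t i <= t i.+1) ->
        P [set w | forall i : nat, (i <= n.+1)%N -> X (t i) w = j (x i)] =
        (P [set w | forall i : nat, (i <= n)%N -> X (t i) w = j (x i)] *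
         (semigroup L (t n.+1 - t n) (fun z : E => (z == x n.+1)%:R) (x n))%:E)%E].

(* Main.v *)
Require Import Defs.
From HB Require Import structures.
From mathcomp Require Import all_boot all_order all_algebra perm zify ring.
From mathcomp Require Import all_classical all_reals all_analysis.

Import Order.TTheory GRing.Theory Num.Theory.
Import numFieldNormedType.Exports.

Set Implicit Arguments.
Unset Strict Implicit.
Unset Printing Implicit Defensive.

Local Open Scope classical_set_scope.
Local Open Scope ring_scope.

(** In an ergodic configuration a particle at [p] is followed either by a
    particle at [p.+1], or by a hole at [p.+1] and then a particle at [p.+2].
    The map [phi] records which alternative occurs for each particle, so it loses
    nothing ([phi_inj]), and the exclusion configuration has [2k - N + 2]
    particles because the [N] bonds of the extended configuration carry one or
    two particles each ([nparticles_phi]).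

    Let [y] be the rank of a particle at [p], and consider the bond
    [(p.+1, p.+2)].  The move 1 1 0 -> 1 0 1 on [p, p.+1, p.+2], and the move
    1 0 1 1 -> 1 1 0 1 on [p, .., p.+3], both exchange the values of [phi eta]
    across the bond [(y.+1, y.+2)] ([phi_exch_right], [phi_exch_left]), and these
    are all the moves that the facilitated dynamics allows.  In an ergodic
    configuration every positive rate of the facilitated generator belongs to a
    bond lying just to the right of a particle.  Its sum over bonds is thus a sum
    over particles, that is, over the bonds of the exclusion process, and it
    agrees with the exclusion generator term by term ([LTA_lifts], [LS_lifts]).

    This intertwining of generators passes to the exponential series, power by
    power.  It shows that the ergodic component is never left: with the constant
    function 0 on the exclusion side, the semigroup of a function vanishing on
    the component vanishes there too.  This gives probability one at a fixed
    time, then at all rational times, then at all times by right continuity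
    ([ae_invariant]).  Finally, since [phi] is injective on the component, the
    event that the image process follows a prescribed path is, up to a null set,
    the event that the original process follows the unique path above it, and the
    Markov property transfers ([markov_process_image]). *)

(** * Occupation variables and exchanges *)

Lemma occ_site (N : nat) (eta : Omega N) (i : 'I_N.-1) : occ eta i.+1 = eta i.
Proof. by rewrite /occ /= valK. Qed.

Lemma site_out (N x : nat) : (N <= x)%N -> site N x = None.
Proof.
case: x => [//|x] hx; rewrite /site insubF //; apply/negbTE; lia.
Qed.

Lemma occ_out (N : nat) (eta : Omega N) (x : nat) : (N <= x)%N -> occ eta x.
Proof. by move=> hx; rewrite /occ site_out. Qed.

Lemma occ_inj (N : nat) (eta zeta : Omega N) :
  (forall x : nat, occ eta x.+1 = occ zeta x.+1) -> eta = zeta.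
Proof. by move=> h; apply/ffunP => i; rewrite -!occ_site. Qed.

Lemma exch_out (N : nat) (eta : Omega N) (x : nat) :
  (N <= x.+1)%N -> exch eta x x.+1 = eta.
Proof. by move=> hx; rewrite /exch (site_out hx); case: (site N x). Qed.

(** Site 0 and the sites from [N] on are never exchanged, so the pair of sites is
    written [x.+1, x.+2] and the second one must lie below [N]. *)
Lemma occ_exch (N : nat) (eta : Omega N) (x z : nat) : (x.+2 < N)%N ->
  occ (exch eta x.+1 x.+2) z =
  occ eta (if z == x.+1 then x.+2 else if z == x.+2 then x.+1 else z).
Proof.
move=> hx.
have hi : (x < N.-1)%N by lia.
have hj : (x.+1 < N.-1)%N by lia.
rewrite /exch /site !insubT /=.
have [zout|] := leqP N z.
  by rewrite !ifF ?occ_out //; apply/negbTE; lia.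
case: z => [//|z] hz.
have hz' : (z < N.-1)%N by lia.
rewrite -[z]/(val (Ordinal hz')) occ_site ffunE permE /=.
rewrite -!val_eqE /= !eqSS.
by case: eqP => [_|_]; [|case: eqP => [_|_]];
  rewrite -occ_site.
Qed.

Lemma exch_exch (N : nat) (eta : Omega N) (x : nat) :
  exch (exch eta x.+1 x.+2) x.+1 x.+2 = eta.
Proof.
have [hx|hx] := leqP N x.+2; first by rewrite !exch_out.
apply: occ_inj => z; rewrite !occ_exch // !eqSS.
case: (eqVneq z x) => [->|/negbTE zx].
  by rewrite ifF ?eqxx //; apply/negbTE; lia.
case: (eqVneq z x.+1) => [->|/negbTE zx1]; first by rewrite eqxx.
by rewrite !eqSS zx zx1.
Qed.

Lemma exch_same (N : nat) (eta : Omega N) (x : nat) :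
  occ eta x.+1 = occ eta x.+2 -> exch eta x.+1 x.+2 = eta.
Proof.
move=> h; have [hx|hx] := leqP N x.+2; first by rewrite exch_out.
by apply: occ_inj => z; rewrite occ_exch //;
  case: eqP => [->//|_]; case: eqP => [->|].
Qed.

(** The boundary particles make the constraint hold on all bonds as soon as it
    holds on the bonds inside the system; this removes all range conditions. *)
Lemma ergodicP (N : nat) (eta : Omega N) :
  ergodic eta <-> forall x : nat, occ eta x || occ eta x.+1.
Proof.
split=> [h [//|x]|h x _ _]; last by have := h x; case: (occ _ _) (occ _ _) => -[].
have [hx|hx] := leqP N x.+2; first by rewrite (occ_out _ hx) orbT.
by have := h x.+1 isT; case: (occ _ _) (occ _ _) => -[] //; apply; lia.
Qed.

(** * Ranks of particles and the map phi *)

Definition rank (N : nat) (eta : Omega N) (p : nat) : nat :=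
  (\sum_(0 <= q < p) occ eta q)%N.

Lemma rankS (N : nat) (eta : Omega N) (p : nat) :
  rank eta p.+1 = (rank eta p + occ eta p)%N.
Proof. by rewrite /rank big_nat_recr. Qed.

Lemma rank_le (N : nat) (eta : Omega N) (p q : nat) :
  (p <= q)%N -> (rank eta p <= rank eta q)%N.
Proof.
by move=> pq; rewrite /rank (big_cat_nat (leq0n p) pq) //= leq_addr.
Qed.

Lemma rank_lt (N : nat) (eta : Omega N) (p q : nat) :
  occ eta p -> (p < q)%N -> (rank eta p < rank eta q)%N.
Proof.
by move=> hp /(rank_le eta); apply: leq_trans; rewrite rankS hp addn1.
Qed.

Lemma rank_inj (N : nat) (eta : Omega N) (p q : nat) :
  occ eta p -> occ eta q -> rank eta p = rank eta q -> p = q.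
Proof.
move=> hp hq e.
case: (ltngtP p q) => // pq; first by have := rank_lt hp pq; rewrite e ltnn.
by have := rank_lt hq pq; rewrite e ltnn.
Qed.

Lemma rank_surj (N : nat) (eta : Omega N) (n y : nat) :
  (y < rank eta n)%N ->
  exists p : nat, [/\ (p < n)%N, occ eta p & rank eta p = y].
Proof.
elim: n => [|n IH]; first by rewrite /rank big_geq.
rewrite rankS; have [/IH[p [hp op rp]] _|hy] := ltnP y (rank eta n).
  by exists p; split => //; apply: ltnW.
case on: (occ eta n); last by lia.
by move=> hy'; exists n; split => //; lia.
Qed.

Lemma rank_all (N k : nat) (eta : Omega N) : (0 < N)%N ->
  nparticles eta = k -> rank eta N = k.+1.
Proof.
case: N eta => [//|n] eta _ <-; rewrite /rank big_nat_recl // big_mkord add1n.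
by congr _.+1; apply: eq_bigr => i _; rewrite -occ_site.
Qed.

(** Along the particles, the rank takes the values 0, 1, 2, .. once each.  This is
    the change of variables between the facilitated process, indexed by sites,
    and the exclusion process, indexed by particles. *)
Lemma big_rank (V : nmodType) (N : nat) (eta : Omega N) (F : nat -> V) (n : nat) :
  \sum_(0 <= p < n | occ eta p) F (rank eta p) =
  \sum_(0 <= y < rank eta n) F y.
Proof.
elim: n => [|n IH]; first by rewrite /rank !big_geq.
rewrite big_mkcond big_nat_recr //= -big_mkcond IH rankS.
by case: (occ eta n); rewrite ?addn1 ?addn0 ?addr0 // big_nat_recr.
Qed.

Lemma nth_particles (N : nat) (eta : Omega N) (p : nat) :
  (p < N)%N -> occ eta p -> nth 0%N (particles eta) (rank eta p) = p.
Proof.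
move=> hp op.
have szE : size [seq x <- iota 0 p | occ eta x] = rank eta p.
  rewrite size_filter -sum1_count big_mkcond /rank /index_iota subn0.
  by apply: eq_bigr => q _; case: occ.
have -> : particles eta = [seq x <- iota 0 (p + (N - p.+1).+1) | occ eta x].
  by rewrite /particles addnS -addSn subnKC.
by rewrite iotaD filter_cat nth_cat szE ltnn subnn /= op.
Qed.

(** The site of the exclusion process attached to a particle at [p] is
    [(rank eta p).+1].  Both sides are boundary values when [N <= p], which spares
    every later lemma a range condition on [p]. *)
Lemma occ_phi (N k : nat) (eta : Omega N) (p : nat) : (0 < N)%N ->
  nparticles eta = k -> occ eta p ->
  occ (phi k eta) (rank eta p).+1 = occ eta p.+1.
Proof.
move=> N0 hk op; have [pN|pN] := leqP N p.
  rewrite !occ_out //; first by lia.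
  by rewrite ltnS -(rank_all N0 hk) rank_le.
have hy : (rank eta p < k.+1)%N by rewrite -(rank_all N0 hk) rank_lt.
rewrite -[rank eta p]/(val (Ordinal hy)) occ_site ffunE /=.
by rewrite nth_particles.
Qed.

(** By ergodicity the next particle sits at [p.+1] or, failing that, at
    [p.+2]. *)
Lemma occ_phi_next (N k : nat) (eta : Omega N) (p : nat) : (0 < N)%N ->
  ergodic_k k eta -> occ eta p ->
  occ (phi k eta) (rank eta p).+2 =
  if occ eta p.+1 then occ eta p.+2 else occ eta p.+3.
Proof.
move=> N0 [/ergodicP erg hk] op; case: ifPn => o1.
  by rewrite -(@occ_phi _ k eta) // rankS op addn1.
have o2 : occ eta p.+2 by have := erg p.+1; rewrite (negbTE o1).
by rewrite -(@occ_phi _ k eta) // !rankS op (negbTE o1) addn0 addn1.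
Qed.

(** Reading from the left, the occupation of [n.+1] is forced: it is given by
    [phi] at the rank of [n] if [n] is occupied, and by ergodicity otherwise. *)
Lemma phi_inj (N k : nat) (eta zeta : Omega N) : (0 < N)%N ->
  ergodic_k k eta -> ergodic_k k zeta -> phi k eta = phi k zeta -> eta = zeta.
Proof.
move=> N0 [/ergodicP e1 k1] [/ergodicP e2 k2] e.
suff h n : occ eta n = occ zeta n /\ rank eta n = rank zeta n.
  by apply: occ_inj => x; have [] := h x.+1.
elim: n => [|n [on rn]]; first by split => //; rewrite /rank !big_geq.
split; last by rewrite !rankS on rn.
case o: (occ eta n); last first.
  by have := e1 n; have := e2 n; rewrite -on o /= => -> ->.
by rewrite -(@occ_phi _ k eta) // -(@occ_phi _ k zeta) -?on // e rn.
Qed.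

(** On each bond [(p, p.+1)] with [p < N], ergodicity gives
    [(both occupied) + 1 = occ p + occ p.+1]; summing, the number of doubly
    occupied bonds is [2 (k + 1) - N]. *)
Lemma nparticles_phi (N k : nat) (eta : Omega N) : (0 < N)%N ->
  ergodic_k k eta -> nparticles (phi k eta) = (2 * k + 2 - N)%N.
Proof.
move=> N0 [/ergodicP erg hk].
have -> : nparticles (phi k eta) =
    (\sum_(0 <= p < N) (occ eta p && occ eta p.+1))%N.
  transitivity (\sum_(0 <= y < rank eta N) occ (phi k eta) y.+1)%N.
    rewrite (@rank_all _ k) // big_mkord; apply: eq_bigr => i _.
    by rewrite occ_site.
  rewrite -(@big_rank nat _ eta (fun y => nat_of_bool (occ (phi k eta) y.+1))).
  rewrite big_mkcond.
  by apply: eq_bigr => p _; case: ifP => // op; rewrite occ_phi.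
have : (\sum_(0 <= p < N) (occ eta p && occ eta p.+1) + N =
        rank eta N + \sum_(0 <= p < N) occ eta p.+1)%N.
  have {4}-> : N = (\sum_(0 <= p < N) 1)%N by rewrite sum_nat_const_nat subn0 muln1.
  rewrite -!big_split /=.
  by apply: eq_bigr => p _ /=; have := erg p; case: occ; case: occ.
have : (\sum_(0 <= p < N) occ eta p.+1 + occ eta 0 = rank eta N.+1)%N.
  by rewrite /rank big_nat_recl // addnC.
rewrite rankS (occ_out _ (leqnn N)) (@rank_all _ k) //= => h1 h2; lia.
Qed.

Lemma occ_lt (N : nat) (eta : Omega N) (x : nat) : ~~ occ eta x -> (x < N)%N.
Proof. by apply: contraR; rewrite -leqNgt => /(occ_out eta). Qed.

(** * Moves of the facilitated process *)

(** The particle of rank [(rank eta p).+1] moves from [p.+1] to [p.+2] without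
    overtaking any other, so all particles keep their rank.  Only it and the
    particle at [p] see a change on their right: the first gains a right
    neighbour, at [p.+3] by ergodicity, and the second loses one. *)
Lemma phi_exch_right (N k : nat) (eta : Omega N) (p : nat) :
  ergodic_k k eta -> occ eta p -> occ eta p.+1 -> ~~ occ eta p.+2 ->
  ergodic_k k (exch eta p.+1 p.+2) /\
  phi k (exch eta p.+1 p.+2) =
    exch (phi k eta) (rank eta p).+1 (rank eta p).+2.
Proof.
move=> [erg hk] o0 o1 o2; have pN := occ_lt o2.
have N0 : (0 < N)%N by lia.
move: (erg) => /ergodicP ergb.
have o3 : occ eta p.+3 by have := ergb p.+2; rewrite (negbTE o2).
set zeta := exch eta p.+1 p.+2.
have oz q : q != p.+1 -> q != p.+2 -> occ zeta q = occ eta q.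
  by move=> h1 h2; rewrite occ_exch // (negbTE h1) (negbTE h2).
have oz1 : occ zeta p.+1 = false by rewrite occ_exch // eqxx (negbTE o2).
have oz2 : occ zeta p.+2 = true by rewrite occ_exch // eqxx ifF // eqn_leq ltnn.
have zk : nparticles zeta = k by rewrite nparticles_exch.
have rz q : (rank zeta q + (q == p.+2) = rank eta q)%N.
  elim: q => [|q IH]; first by rewrite /rank !big_geq.
  rewrite !rankS eqSS; move: IH.
  case: (eqVneq q p.+1) => [->|h1]; first by rewrite oz1 o1; lia.
  case: (eqVneq q p.+2) => [->|h2]; first by rewrite oz2 (negbTE o2); lia.
  by rewrite oz //; lia.
have rz' q : q != p.+2 -> rank zeta q = rank eta q.
  by move=> /negbTE h; rewrite -rz h addn0.
split.
  split=> //; apply/ergodicP => x.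
  case: (eqVneq x p.+2) => [->|h2]; first by rewrite oz2.
  case: (eqVneq x p.+1) => [->|h1]; first by rewrite oz2 orbT.
  case: (eqVneq x p) => [->|h0]; first by rewrite oz ?o0 //; lia.
  by rewrite !oz //; lia.
have ry : ((rank eta p).+2 < k.+2)%N.
  rewrite -(rank_all N0 hk) ltnS.
  by apply: leq_trans (rank_le eta pN); rewrite !rankS o0 o1; lia.
have r1 : rank eta p.+1 = (rank eta p).+1 by rewrite rankS o0 addn1.
apply: occ_inj => z.
have [zk1|zk1] := leqP k.+1 z; first by rewrite !occ_out.
have [q [qN oq rq]] : exists q, [/\ (q < N)%N, occ zeta q & rank zeta q = z].
  by apply: rank_surj; rewrite (rank_all N0 zk).
rewrite -{1}rq occ_phi // occ_exch // !eqSS -rq.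
case: (eqVneq q p.+1) => [e|q1]; first by rewrite e oz1 in oq.
case: (eqVneq q p.+2) => [->|q2].
  (* The moved particle: same rank as before, now at site p.+2. *)
  have -> : rank zeta p.+2 = (rank eta p).+1.
    by have := rz p.+2; rewrite eqxx !rankS o0 o1; lia.
  rewrite ifF; last by apply/negbTE; lia.
  by rewrite eqxx occ_phi // o1 oz //; lia.
rewrite rz' //; have oq' : occ eta q by rewrite -oz.
case: (eqVneq q p) => [->|q0].
  by rewrite eqxx oz1 -r1 occ_phi // (negbTE o2).
rewrite !ifF ?occ_phi // ?oz //; try lia.
  by apply/negbTE/eqP; rewrite -r1 => /(rank_inj oq' o1); lia.
by apply/negbTE/eqP => /(rank_inj oq' o0); lia.
Qed.

(** This is [phi_exch_right] read backwards: the new configuration may jump to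
    the right across the same bond, and exchanges are involutions.  When the hole
    is at [N.-1], both exchanges touch the boundary and do nothing. *)
Lemma phi_exch_left (N k : nat) (eta : Omega N) (p : nat) :
  ergodic_k k eta -> occ eta p -> ~~ occ eta p.+1 -> occ eta p.+3 ->
  ergodic_k k (exch eta p.+1 p.+2) /\
  phi k (exch eta p.+1 p.+2) =
    exch (phi k eta) (rank eta p).+1 (rank eta p).+2.
Proof.
move=> hE o0 o1 o3; have [erg hk] := hE; have pN := occ_lt o1.
have N0 : (0 < N)%N by lia.
move: (erg) => /ergodicP ergb.
have o2 : occ eta p.+2 by have := ergb p.+1; rewrite (negbTE o1).
have [pN2|pN2] := leqP N p.+2.
  rewrite !exch_out //; rewrite -(rank_all N0 hk) ltnS.
  by apply: (leq_trans (rank_le eta pN2)); rewrite !rankS o0 (negbTE o1); lia.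
set zeta := exch eta p.+1 p.+2.
have zp : occ zeta p by rewrite occ_exch // !ifF //; apply/negbTE; lia.
have zp1 : occ zeta p.+1 by rewrite occ_exch // eqxx.
have zp2 : ~~ occ zeta p.+2 by rewrite occ_exch // eqxx ifF // eqn_leq ltnn.
have rz : rank zeta p = rank eta p.
  apply: eq_big_nat => q /andP[_ qp].
  by rewrite occ_exch // !ifF //; apply/negbTE; lia.
have zE : ergodic_k k zeta.
  split; last by rewrite nparticles_exch.
  apply/ergodicP => x.
  case: (eqVneq x p) => [->|h0]; first by rewrite zp.
  case: (eqVneq x p.+1) => [->|h1]; first by rewrite zp1.
  case: (eqVneq x p.+2) => [->|h2].
    by rewrite [X in _ || X]occ_exch // !ifF ?o3 ?orbT //; apply/negbTE; lia.
  by rewrite !occ_exch // !ifF //; apply/negbTE; lia.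
split=> //.
have [_] := phi_exch_right zE zp zp1 zp2.
by rewrite exch_exch rz => ->; rewrite exch_exch.
Qed.

(** * Intertwining of the generators *)

Lemma sum_bonds (V : nmodType) (n m : nat) (F : nat -> V) :
  (n <= m.+1)%N -> (forall x : nat, (n <= x)%N -> F x = 0) ->
  \sum_(1 <= x < n) F x = \sum_(0 <= p < m) F p.+1.
Proof.
move=> nm F0; rewrite -(big_add1 _ _ 0 m.+1 xpredT F).
have tail0 i j : (n <= i)%N -> \sum_(i <= x < j) F x = 0.
  move=> ni; rewrite big_nat big1 // => x /andP[ix _].
  by apply: F0; apply: leq_trans ix.
have [n0|n0] := posnP n; first by rewrite !tail0 // n0.
by rewrite (big_cat_nat n0 nm) /= (tail0 n) // addr0.
Qed.

(** On the ergodic component, [f] is [g \o phi].  A relation is more convenient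
    than a composition here because [phi] has no range in [Omega_k] outside the
    component. *)
Definition lifts (R : Type) (N k l : nat) (f : Omega N -> R)
    (g : Omega_k k.+2 l -> R) : Prop :=
  forall (eta : Omega N) (z : Omega_k k.+2 l),
    ergodic_k k eta -> phi k eta = sval z -> f eta = g z.

Lemma exch_k_id (M l : nat) (z : Omega_k M l) (x x' : nat) :
  exch (sval z) x x' = sval z -> exch_k z x x' = z.
Proof. by move=> h; apply: val_inj. Qed.

Section Intertwining.
Variables (R : realType) (N k l : nat).
Hypothesis N0 : (0 < N)%N.
Variables (f : Omega N -> R) (g : Omega_k k.+2 l -> R).
Hypothesis fg : lifts f g.
Variables (eta : Omega N) (z : Omega_k k.+2 l).
Hypothesis hE : ergodic_k k eta.
Hypothesis hz : phi k eta = sval z.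

Let ergb : forall x, occ eta x || occ eta x.+1.
Proof. by case: hE => /ergodicP. Qed.

(** A sum over bonds of [N] sites that is supported on the bonds to the right of
    a particle is, through the ranks, a sum over the bonds of the exclusion
    process. *)
Lemma sum_particles (F G : nat -> R) :
  (forall x, (N.-1 <= x)%N -> F x = 0) ->
  (forall p, ~~ occ eta p -> F p.+1 = 0) ->
  (forall y, (k.+1 <= y)%N -> G y = 0) ->
  (forall p, occ eta p -> F p.+1 = G (rank eta p).+1) ->
  \sum_(1 <= x < N.-1) F x = \sum_(1 <= y < k.+1) G y.
Proof.
move=> F0 Fp G0 FG; have [_ hk] := hE.
rewrite (@sum_bonds _ _ N) //; last by lia.
rewrite (@sum_bonds _ _ k.+1) // -(rank_all N0 hk).
rewrite -(big_rank eta (fun y => G y.+1)) [RHS]big_mkcond.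
by apply: eq_bigr => p _; case: ifPn => [/FG|/Fp].
Qed.

Lemma diff_right (p : nat) : occ eta p -> occ eta p.+1 -> ~~ occ eta p.+2 ->
  f (exch eta p.+1 p.+2) - f eta =
  g (exch_k z (rank eta p).+1 (rank eta p).+2) - g z.
Proof.
move=> o0 o1 o2; have [zE ze] := phi_exch_right hE o0 o1 o2.
rewrite (fg hE hz) (fg (z := exch_k z (rank eta p).+1 (rank eta p).+2)) //=.
by rewrite ze hz.
Qed.

Lemma diff_left (p : nat) : occ eta p -> ~~ occ eta p.+1 -> occ eta p.+3 ->
  f (exch eta p.+1 p.+2) - f eta =
  g (exch_k z (rank eta p).+1 (rank eta p).+2) - g z.
Proof.
move=> o0 o1 o2; have [zE ze] := phi_exch_left hE o0 o1 o2.
rewrite (fg hE hz) (fg (z := exch_k z (rank eta p).+1 (rank eta p).+2)) //=.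
by rewrite ze hz.
Qed.

Lemma LTA_lifts : LTA f eta = EPTA g z.
Proof.
have [_ hk] := hE.
apply: sum_particles => [x hx|p /negbTE o0|y hy|p o0].
- by rewrite exch_out ?subrr ?mulr0 //; lia.
- by rewrite /= o0 !mul0r.
- by rewrite exch_k_id ?exch_out // subrr mulr0.
rewrite /= -hz occ_phi // occ_phi_next // o0 mul1r.
case: ifPn => [ o1|_]; last by rewrite !mul0r.
case: (boolP (occ eta p.+2)) => [ o2|o2]; first by rewrite subrr !mulr0 !mul0r.
by rewrite diff_right.
Qed.

Lemma LS_lifts : LS f eta = EPS g z.
Proof.
have [_ hk] := hE.
apply: sum_particles => [x hx|p o0|y hy|p o0].
- by rewrite exch_out ?subrr ?mulr0 //; lia.
  (* Without a particle at p, ergodicity occupies p.+1 and kills both rates. *)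
- have := ergb p; rewrite /= (negbTE o0) /= => ->.
  by rewrite subrr !mul0r addr0 mul0r.
- by rewrite exch_k_id ?exch_out // subrr.
have e1 := occ_phi N0 hk o0; have e2 := occ_phi_next N0 hE o0.
move: e1 e2; rewrite hz /= o0 => e1 e2.
have same : occ (sval z) (rank eta p).+1 = occ (sval z) (rank eta p).+2 ->
    g (exch_k z (rank eta p).+1 (rank eta p).+2) - g z = 0.
  by move=> e; rewrite exch_k_id ?subrr // exch_same.
move: same; rewrite e1 e2.
case: (boolP (occ eta p.+1)) => o1 same.
  case: (boolP (occ eta p.+2)) => o2.
    by rewrite same ?o2 // !(subrr, mulr0, mul0r, addr0).
  by rewrite diff_right // !(subr0, subrr, mul1r, mul0r, addr0).
have -> : occ eta p.+2 by have := ergb p.+1; rewrite (negbTE o1).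
case: (boolP (occ eta p.+3)) => o3.
  by rewrite diff_left // !(subr0, subrr, mul1r, mul0r, add0r).
by rewrite same ?(negbTE o3) // !(mulr0, mul0r, addr0).
Qed.

End Intertwining.

Lemma FEP_generator_lifts (R : realType) (sigma p kappa : R) (N k l : nat)
    (f : Omega N -> R) (g : Omega_k k.+2 l -> R) : (0 < N)%N ->
  lifts f g ->
  lifts (FEP_generator sigma p kappa f) (EP_generator sigma p kappa N g).
Proof.
move=> N0 fg eta z hE hz.
rewrite /FEP_generator /EP_generator.
by rewrite (LS_lifts N0 fg hE hz) (LTA_lifts N0 fg hE hz).
Qed.

Lemma EP_generator0 (R : realType) (sigma p kappa : R) (N M l : nat) :
  EP_generator sigma p kappa N (fun _ : Omega_k M l => 0) = (fun=> 0).
Proof.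
apply/funext => z; rewrite /EP_generator /EPS /EPTA !big1 ?mulr0 ?addr0 ?mulr0 //.
  by move=> y _; rewrite subrr mulr0.
by move=> y _; rewrite subrr.
Qed.

(** An exchange across a bond whose two sites agree changes nothing, so the
    symmetric part, which has rate 1 on every bond, may be charged to jumps in
    either direction. *)
Lemma SEP_generatorE (R : realType) (sigma p kappa : R) (N M l : nat) :
  @SEP_generator R (Theta kappa N * (sigma + p * N%:R `^ (- kappa)))
    (Theta kappa N * sigma) M l = @EP_generator R sigma p kappa N M l.
Proof.
apply/funext => g; apply/funext => z.
rewrite /SEP_generator /EP_generator /EPS /EPTA !mulr_sumr -big_split mulr_sumr.
rewrite [LHS]big_nat [RHS]big_nat; apply: eq_bigr => y /andP[y1 _] /=.
have same : occ (sval z) y = occ (sval z) y.+1 -> g (exch_k z y y.+1) - g z = 0.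
  case: y y1 => // y _ e; rewrite exch_k_id ?subrr // exch_same //.
have [e|] := eqVneq (occ (sval z) y) (occ (sval z) y.+1).
  by rewrite same //; ring.
by case: (occ _ y) (occ _ y.+1) => -[] //= _; ring.
Qed.

(** * Injective images of Markov processes *)

Lemma le_measure_ae (R : realType) (d : measure_display) (T : measurableType d)
    (P : {measure set T -> \bar R}) (A B : set T) :
  measurable A -> measurable B -> {ae P, forall w, A w -> B w} ->
  (P A <= P B)%E.
Proof.
move=> mA mB [Z [mZ Z0 AB]]; rewrite -(measureU0 mB mZ Z0).
apply: le_measure; rewrite ?inE //; first exact: measurableU.
move=> w Aw; case: (pselect (B w)) => Bw; [by left | right].
by apply: AB => /= /(_ Aw).
Qed.

Lemma eq_measure_ae (R : realType) (d : measure_display) (T : measurableType d)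
    (P : {measure set T -> \bar R}) (A B : set T) :
  measurable A -> measurable B -> {ae P, forall w, A w <-> B w} -> P A = P B.
Proof.
move=> mA mB AB; apply/eqP; rewrite eq_le.
by apply/andP; split; apply: le_measure_ae => //; apply: filterS AB => w [].
Qed.

Lemma measurable_path (R : realType) (d : measure_display)
    (T : measurableType d) (S : finType) (X : R -> T -> S) (n : nat)
    (t : nat -> R) (A : nat -> set S) :
  (forall (t : R) (s : S), 0 <= t -> measurable [set w | X t w = s]) ->
  (forall i : nat, 0 <= t i) ->
  measurable [set w | forall i : nat, (i <= n)%N -> A i (X (t i) w)].
Proof.
move=> mX t0.
have -> : [set w | forall i : nat, (i <= n)%N -> A i (X (t i) w)] =
    \bigcap_(i in `I_n.+1) \bigcup_(s in A i) [set w | X (t i) w = s].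
  apply/seteqP; split => w /= h i hi; first by exists (X (t i) w) => //; apply: h.
  by have [s As /= ->] := h i hi.
apply: fin_bigcap_measurable => [|i _]; first exact: finite_II.
by apply: fin_bigcup_measurable => [|s _]; [exact: finite_finset | exact: mX].
Qed.

(** [G] is a part of the state space where [h] is injective with values in the
    image of [j].  The generators are intertwined there in the relational sense:
    [LL'] says that if [f] corresponds to [g] on [G], then [L f] corresponds to
    [L' g]. *)
Section MarkovImage.
Variables (R : realType) (S S' E : finType).
Variables (G : set S) (h : S -> S') (j : E -> S').
Variables (L : (S -> R) -> (S -> R)) (L' : (E -> R) -> (E -> R)).
Hypothesis hG : forall s, G s -> exists x : E, h s = j x.
Hypothesis h_inj : forall s s', G s -> G s' -> h s = h s' -> s = s'.
Hypothesis j_inj : injective j.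
Hypothesis LL' : forall (f : S -> R) (g : E -> R),
  (forall s x, G s -> h s = j x -> f s = g x) ->
  forall s x, G s -> h s = j x -> L f s = L' g x.
Hypothesis L'0 : L' (fun=> 0) = fun=> 0.

(** The two exponential series have the same terms, so no convergence is
    involved. *)
Lemma semigroup_intertwined (t : R) (f : S -> R) (g : E -> R) :
  (forall s x, G s -> h s = j x -> f s = g x) ->
  forall s x, G s -> h s = j x -> semigroup L t f s = semigroup L' t g x.
Proof.
move=> fg s x Gs hs; rewrite /semigroup.
congr (limn (series _)); apply/funext => n; congr (_ * _).
by elim: n s x Gs hs => [|n IH] s x Gs hs /=; [exact: fg | exact: LL'].
Qed.

(** A function vanishing on [G] corresponds to the constant 0 on [E]. *)
Lemma semigroup_vanishes (t : R) (f : S -> R) :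
  (forall s, G s -> f s = 0) -> forall s, G s -> semigroup L t f s = 0.
Proof.
move=> f0 s Gs; have [x hx] := hG Gs.
rewrite (@semigroup_intertwined _ _ (fun=> 0) _ _ x) //; last first.
  by move=> s' x' Gs' _; exact: f0.
rewrite /semigroup; apply: lim_near_cst => //; apply: nearW => n.
rewrite /series /= big1 // => i _.
suff -> : iter i L' (fun=> 0) = fun=> 0 by rewrite mulr0.
by elim: i => //= i ->.
Qed.

Section Process.
Variables (d : measure_display) (T : measurableType d) (P : probability T R).
Variable X : R -> T -> S.
Hypothesis XM : markov_process P id L X.
Hypothesis X0 : {ae P, forall w, G (X 0 w)}.

(** The Markov property for the times [0 <= t] makes the probability of being
    at [s] in [G] and then at [s'] outside [G] proportional to the semigroup of
    the indicator of [s'] at [s], which is zero; there are finitely many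
    such pairs. *)
Lemma ae_invariant_at (t : R) : 0 <= t -> {ae P, forall w, G (X t w)}.
Proof.
move=> t0; have [mX _ _ MX] := XM.
have pair0 s s' : G s -> ~ G s' ->
    P ([set w | X 0 w = s] `&` [set w | X t w = s']) = 0.
  move=> Gs Gs'.
  have := MX 0%N (fun i => if i is 0%N then 0 else t)
    (fun i => if i is 0%N then s else s') (lexx _).
  rewrite (semigroup_vanishes _ _ Gs) ?mule0; last first.
    by move=> z Gz; case: eqP => // e; case: Gs'; rewrite -e.
  move=> <-; last by case.
  congr (P _); apply/seteqP; split => [w [e0 e1] [|[|]] //|w /= e].
  by split; [exact: (e 0%N) | exact: (e 1%N)].
have avoid (s s' : S) :
    {ae P, forall w, G s -> ~ G s' -> ~ (X 0 w = s /\ X t w = s')}.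
  have [Gs|nGs] := pselect (G s); last by apply: aeW.
  have [Gs'|nGs'] := pselect (G s'); first by apply: aeW.
  exists ([set w | X 0 w = s] `&` [set w | X t w = s']); split.
  - by apply: measurableI; apply: mX.
  - exact: pair0.
  by move=> w /= /not_implyP[_ /not_implyP[_ /contrapT]].
have {avoid} : {ae P, forall w, forall ss : S * S,
    G ss.1 -> ~ G ss.2 -> ~ (X 0 w = ss.1 /\ X t w = ss.2)}.
  by apply: filter_forall => -[s s'] /=.
apply: filterS2 X0 => w G0 /(_ (X 0 w, X t w) G0) /= nG.
by apply: contrapT => /nG; apply.
Qed.

(** A path is constant immediately after each time [t], hence takes its value at
    [t] again at some rational time. *)
Lemma ae_invariant : {ae P, forall w, forall t : R, 0 <= t -> G (X t w)}.
Proof.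
have [_ cX _ _] := XM.
have : {ae P, forall w, forall n : nat,
    G (X `|ratr (odflt 0 (unpickle n : option rat))| w)}.
  by apply: ae_foralln => n; apply: ae_invariant_at.
apply: filterS => w GX t t0; have [rc _] := cX w.
have [e /= e0 he] := rc t t0.
have te : t < t + e by rewrite ltrDl.
have [q /[!in_itv] /= /andP[tq qe]] := rat_in_itvoo te.
rewrite -(he (ratr q)) //=; last first.
  by rewrite distrC ger0_norm ?ltrBlDl ?subr_ge0 // ltW.
have := GX (pickle q); rewrite pickleK /= ger0_norm //.
exact: le_trans (ltW tq).
Qed.

(** A target [y] with no preimage in [G] is never reached: its indicator
    corresponds to the zero function. *)
Lemma semigroup_indicator (t : R) (x y : E) (s : S) : G s -> h s = j x ->
  semigroup L' t (fun z => (z == y)%:R) x =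
  if pselect (exists2 s', G s' & h s' = j y) is left e
  then semigroup L t (fun z => (z == s2val (cid2 e))%:R) s else 0.
Proof.
move=> Gs hs; case: pselect => [e|ne].
  case: (cid2 e) => s' Gs' hs' /=; apply/esym/semigroup_intertwined => //.
  move=> z z' Gz hz; congr (_%:R); congr (nat_of_bool _); apply/eqP/eqP => [zs|zy].
    by apply: j_inj; rewrite -hz zs.
  by apply: h_inj => //; rewrite hz zy.
rewrite -(@semigroup_intertwined t (fun=> 0) _ _ s x) ?semigroup_vanishes //.
by move=> z z' Gz hz; case: eqP => // e; case: ne; exists z => //; rewrite hz e.
Qed.

(** A path of the image process lifts to a unique path in [G] or to none; in the
    latter case both sides of the Markov property vanish. *)
Lemma markov_process_image : markov_process P j L' (fun t w => h (X t w)).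
Proof.
have [mX cX _ MX] := XM; split.
- move=> t s t0.
  have -> : [set w | h (X t w) = s] =
      \bigcup_(s' in [set s' | h s' = s]) [set w | X t w = s'].
    apply/seteqP; split=> [w /= <-|w [s' /= <- <-]//].
    by exists (X t w).
  apply: fin_bigcup_measurable => [|s' _]; [exact: finite_finset | exact: mX].
- move=> w; have [rc ll] := cX w; split=> [t /rc|t /ll[x xt]].
    by apply: filterS => u ->.
  by exists (h x); apply: filterS xt => u ->.
- by apply: filterS ae_invariant => w GX t /GX /hG.
move=> n t x t0 tS.
have tge0 i : 0 <= t i by elim: i => // i IH; apply: le_trans (tS i).
pose C i := exists2 s, G s & h s = j (x i).
pose path m (y : nat -> S) := [set w | forall i, (i <= m)%N -> X (t i) w = y i].
pose hpath m := [set w | forall i, (i <= m)%N -> h (X (t i) w) = j (x i)].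
have mh m : measurable (hpath m).
  exact: (@measurable_path _ _ _ _ _ _ _ (fun i => [set s | h s = j (x i)])).
have mp m y : measurable (path m y).
  exact: (@measurable_path _ _ _ _ _ _ _ (fun i => [set s | s = y i])).
have hpath0 m i : (i <= m)%N -> ~ C i -> P (hpath m) = 0.
  move=> im nC; rewrite -(measure0 P); apply: eq_measure_ae => //.
  apply: filterS ae_invariant => w GX; split=> // hw; case: nC.
  by exists (X (t i) w); [exact: GX | exact: hw].
have hpathE m y : (forall i, (i <= m)%N -> G (y i) /\ h (y i) = j (x i)) ->
    P (hpath m) = P (path m y).
  move=> hy; apply: eq_measure_ae => //.
  apply: filterS ae_invariant => w GX; split=> hw i im; have [Gy yx] := hy i im.
    by apply: h_inj => //; [exact: GX | rewrite yx; exact: hw].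
  by rewrite hw.
rewrite -/(hpath n.+1) -/(hpath n).
have [Cn|] := pselect (forall i, (i <= n)%N -> C i); last first.
  move=> /existsNP[i /not_implyP[im nC]].
  by rewrite (hpath0 n i) // (hpath0 n.+1 i) ?mul0e // ltnW.
pose s0 : S := s2val (cid2 (Cn 0%N isT)).
(* The default state s0 fills in the indices without preimage, all beyond n. *)
pose y i := if pselect (C i) is left e then s2val (cid2 e) else s0.
have yP i : C i -> G (y i) /\ h (y i) = j (x i).
  by move=> Ci; rewrite /y; case: pselect => // e; case: (cid2 e).
have [Gy hy] := yP n (Cn n (leqnn n)).
rewrite (hpathE n y) => [|i im]; last exact/yP/Cn.
rewrite (semigroup_indicator _ _ Gy hy).
case: pselect => [e|ne]; last by rewrite mule0 (hpath0 n.+1 n.+1).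
rewrite (hpathE n.+1 y) => [|i]; last first.
  by rewrite leq_eqVlt => /predU1P[-> | /Cn /yP //]; apply: yP.
rewrite MX //; do 4!congr (_ _); apply/funext => z.
by rewrite /y; case: pselect => [e'|//]; rewrite (Prop_irrelevance e e').
Qed.

End Process.
End MarkovImage.

(** * The facilitated process as an exclusion process *)

Unset Implicit Arguments.

Theorem theorem1 (R : realType) (N k : nat) (sigma p kappa : R)
    (d : measure_display) (T : measurableType d) (P : probability T R)
    (eta : R -> T -> Omega N)
    (hN : (2 <= N)%N) (hk : (N.-1 %/ 2 <= k <= N.-1)%N)
    (hsigma : 0 < sigma) (hp : 0 <= p) (hkappa : 0 <= kappa)
    (heta : markov_process P id (@FEP_generator R sigma p kappa N) eta)
    (heta0 : {ae P, forall w, ergodic_k k (eta 0 w)}) :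
  let M := k.+2 in
  let l := (2 * k + 2 - N)%N in
  let xi := fun (t : R) (w : T) => phi k (eta t w) in
  markov_process P (sval : Omega_k M l -> Omega M)
    (@EP_generator R sigma p kappa N M l) xi /\
  markov_process P (sval : Omega_k M l -> Omega M)
    (@SEP_generator R (Theta kappa N * (sigma + p * N%:R `^ (- kappa)))
       (Theta kappa N * sigma) M l) xi.
Proof.
move=> M l xi; rewrite SEP_generatorE.
have N0 : (0 < N)%N := ltnW hN.
suff H : markov_process P (sval : Omega_k M l -> Omega M)
    (@EP_generator R sigma p kappa N M l) xi by [].
apply: (markov_process_image (G := [set z | ergodic_k k z]) _ _ _ _ _ heta heta0).
- move=> z zE; have zk : nparticles (phi k z) == l by rewrite nparticles_phi.
  by exists (exist _ (phi k z) zk).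
- by move=> z z'; exact: phi_inj.
- exact: val_inj.
- by move=> f g; exact: FEP_generator_lifts.
- exact: EP_generator0.
Qed.
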